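(* Let $\mathcal{H}$ be a complex Hilbert space and let $A,B\in\mathcal{B}(\mathcal{H})$. Then, for each choice of the sign $\pm$, $$ w(AB\pm BA)\leq 2\sqrt{2}\,\|B\|\sqrt{w^2(A)-\frac{\big|\,\|\Re(A)+\Im(A)\|^2-\|\Re(A)-\Im(A)\|^2\,\big|}{4}}. $$
   Context: $\mathcal{B}(\mathcal{H})$ denotes the $C^*$-algebra of bounded linear operators on the complex Hilbert space $\mathcal{H}$, with operator norm $\|\cdot\|$. For $A\in\mathcal{B}(\mathcal{H})$ with adjoint $A^*$: $\Re(A)=\frac{1}{2}(A+A^* )$ and $\Im(A)=\frac{1}{2\mathrm{i}}(A-A^* )$ (self-adjoint operators). The numerical radius is $w(A)=\sup\{|\langle Ax,x\rangle|: x\in\mathcal{H},\ \|x\|=1\}$, and $w^2(A)=(w(A))^2$. *)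

(* Defs.v *)
From HB Require Import structures.
From mathcomp Require Import all_boot all_order all_algebra.
From mathcomp Require Import complex.
From mathcomp Require Import all_classical all_reals all_analysis.
Set Implicit Arguments.
Unset Strict Implicit.
Unset Printing Implicit Defensive.
Import Order.TTheory GRing.Theory Num.Theory.
Import numFieldNormedType.Exports.
Local Open Scope classical_set_scope.
Local Open Scope complex_scope.
Local Open Scope ring_scope.

(* A complex Hilbert space: a complete normed R[i]-module whose norm comes from
   an inner product, linear in the first argument and conjugate-linear in the
   second. *)
HB.mixin Record isHilbert (R : realType) H
    of CompleteNormedModule R[i] H := {
  inner : {dot H for (@Num.conj R[i])} ;
  inner_norm : forall x : H, `|x| ^+ 2 = inner x x
}.

#[short(type="hilbertType")]
HB.structure Definition Hilbert (R : realType) :=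
  { H of CompleteNormedModule R[i] H & isHilbert R H }.

Section Operators.
Context {R : realType} {H : hilbertType R}.
Implicit Types A : H -> H.

Definition bounded_operator (A : {linear H -> H}) : Prop :=
  exists M : R, forall x : H, `|A x| <= M%:C * `|x|.

(* Norms and moduli are R[i]-valued here (real and nonnegative); Re maps them
   back to R, where suprema are taken. *)
Definition opnorm A : R :=
  sup [set complex.Re `|A x| | x in [set x : H | `|x| <= 1]].

(* sup set0 = 0, so w(A) = 0 on the zero space. *)
Definition numradius A : R :=
  sup [set complex.Re `|inner (A x) x| | x in [set x : H | `|x| = 1]].

(* A* y is the unique z such that <A x, y> = <x, z> for all x; for a bounded
   operator A it exists by the Riesz representation theorem (the default value
   0 is then never used). *)
Definition adjoint A : H -> H := fun y =>
  xget 0 [set z : H | forall x : H, inner (A x) y = inner x z].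

Definition reop A : H -> H := fun x => 2^-1 *: (A x + adjoint A x).

Definition imop A : H -> H := fun x => (2 * 'i)^-1 *: (A x - adjoint A x).

End Operators.

(* Main.v *)
(* Write A = P + iQ with P = Re A and Q = Im A.  For a unit vector x,
   |<(AB +- BA)x, x>| = |<Bx, A* x> +- <BAx, x>| <= ||B|| (||A* x|| + ||Ax||)
                      <= sqrt 2 ||B|| sqrt (||Ax||^2 + ||A* x||^2),
   and ||Ax||^2 + ||A* x||^2 = ||(P+Q)x||^2 + ||(P-Q)x||^2 <= a + b, where
   a = ||P+Q||^2 and b = ||P-Q||^2.  Both a and b are at most 2 w(A)^2, because
   P+Q and P-Q are self-adjoint with quadratic forms Re <Ax,x> +- Im <Ax,x>;
   hence a + b = 2 max(a,b) - |a-b| <= 4 (w(A)^2 - |a-b|/4).  The adjoint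
   exists by the Riesz representation theorem, proved by minimizing
   ||x||^2 - 2 Re f(x). *)

Require Import Defs.
From HB Require Import structures.
From mathcomp Require Import all_boot all_order all_algebra.
From mathcomp Require Import complex.
From mathcomp Require Import all_classical all_reals all_analysis.
From mathcomp Require Import ring lra.
Set Implicit Arguments.
Unset Strict Implicit.
Unset Printing Implicit Defensive.
Import Order.TTheory GRing.Theory Num.Theory.
Import numFieldNormedType.Exports.
Local Open Scope ring_scope.

Local Notation Re := complex.Re.
Local Notation Im := complex.Im.
Local Notation nrm x := (Re `|x|).

(** * Real and complex Cauchy-Schwarz inequalities, and the parallelogram law *)

Section RealInnerProduct.
Context {R : realType} {H : hilbertType R}.
Implicit Types (x y z : H) (t : R) (a : R[i]).

Definition rinner x y : R := Re (inner x y).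

Lemma ReD a b : Re (a + b) = Re a + Re b. Proof. by case: a b => ? ? []. Qed.
Lemma ImD a b : Im (a + b) = Im a + Im b. Proof. by case: a b => ? ? []. Qed.
Lemma ReN a : Re (- a) = - Re a. Proof. by case: a. Qed.
Lemma ImN a : Im (- a) = - Im a. Proof. by case: a. Qed.
Lemma ReM a b : Re (a * b) = Re a * Re b - Im a * Im b.
Proof. by case: a b => ? ? []. Qed.

Lemma Re_conj a : Re (conjc a) = Re a. Proof. by case: a. Qed.
Lemma Im_conj a : Im (conjc a) = - Im a. Proof. by case: a. Qed.

Lemma nrmE (V : normedZmodType R[i]) (v : V) : `|v| = (nrm v)%:C%C.
Proof. by rewrite RRe_real // normr_real. Qed.

Lemma nrm_ge0 (V : normedZmodType R[i]) (v : V) : 0 <= nrm v.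
Proof. by rewrite -ler0c -nrmE. Qed.

Lemma nrm_real t : 0 <= t -> nrm (t%:C%C) = t.
Proof. by move=> t0; rewrite ger0_norm ?ler0c. Qed.

Lemma ler_nrmD (V : normedZmodType R[i]) (v w : V) :
  nrm (v + w) <= nrm v + nrm w.
Proof. by have := ler_normD v w; rewrite lecE ReD => /andP[]. Qed.

Lemma nrmM a b : nrm (a * b) = nrm a * nrm b.
Proof. by rewrite normrM ReM [Im `|a|]ger0_Im // mul0r subr0. Qed.

Lemma sqr_nrmc a : nrm a ^+ 2 = Re a ^+ 2 + Im a ^+ 2.
Proof. by apply: (@complexI R); rewrite add_Re2_Im2 [in RHS]nrmE -rmorphXn. Qed.

Lemma sqr_nrm x : nrm x ^+ 2 = rinner x x.
Proof. by rewrite /rinner -inner_norm nrmE -rmorphXn. Qed.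

Lemma nrmZ a x : nrm (a *: x) = nrm a * nrm x.
Proof. by rewrite normrZ ReM [Im `|a|]ger0_Im // mul0r subr0. Qed.

Lemma innerC x y : inner x y = conjc (inner y x).
Proof. by rewrite hermC expr0 mul1r. Qed.

(* The generic bilinearity lemmas leave [inner] behind an applied coercion that
   later rewrites cannot match. *)
Lemma innerDl x y z : inner (x + y) z = inner x z + inner y z.
Proof. exact: linearDl. Qed.

Lemma innerDr x y z : inner x (y + z) = inner x y + inner x z.
Proof. exact: linearDr. Qed.

Lemma innerBl x y z : inner (x - y) z = inner x z - inner y z.
Proof. exact: linearBl. Qed.

Lemma innerBr x y z : inner x (y - z) = inner x y - inner x z.
Proof. exact: linearBr. Qed.

Lemma rinnerC x y : rinner x y = rinner y x.
Proof. by rewrite /rinner innerC Re_conj. Qed.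

Lemma rinnerDl x y z : rinner (x + y) z = rinner x z + rinner y z.
Proof. by rewrite /rinner linearDl ReD. Qed.

Lemma rinnerDr x y z : rinner x (y + z) = rinner x y + rinner x z.
Proof. by rewrite ![rinner x _]rinnerC rinnerDl. Qed.

Lemma rinnerZl t x y : rinner (t%:C%C *: x) y = t * rinner x y.
Proof. by rewrite /rinner linearZl_LR ReM /= mul0r subr0. Qed.

Lemma rinnerZr t x y : rinner x (t%:C%C *: y) = t * rinner x y.
Proof. by rewrite rinnerC rinnerZl rinnerC. Qed.

Lemma rinnerNl x y : rinner (- x) y = - rinner x y.
Proof. by rewrite /rinner linearNl ReN. Qed.

Lemma rinnerNr x y : rinner x (- y) = - rinner x y.
Proof. by rewrite rinnerC rinnerNl rinnerC. Qed.

Definition rinnerE :=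
  (rinnerDl, rinnerDr, rinnerNl, rinnerNr, rinnerZl, rinnerZr).

Lemma parallelogram x y :
  nrm (x + y) ^+ 2 + nrm (x - y) ^+ 2 = 2 * (nrm x ^+ 2 + nrm y ^+ 2).
Proof. by rewrite !sqr_nrm !rinnerE [rinner y x]rinnerC; ring. Qed.

(** For [a > 0], evaluate at the vertex [- b / a]; for [a = 0], an affine function bounded below
    must be constant. *)
Lemma discriminant_le (a b c : R) : 0 <= a ->
  (forall t, 0 <= a * t ^+ 2 + 2 * b * t + c) -> b ^+ 2 <= a * c.
Proof.
rewrite le_eqVlt => /predU1P[<- h | a0 h].
  rewrite mul0r; have [-> | b0] := eqVneq b 0; first by rewrite expr0n.
  (* At this point the affine function [2 * b * t + c] takes the value -1. *)
  have := h (- (c + 1) / (2 * b)).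
  have -> : 0 * (- (c + 1) / (2 * b)) ^+ 2 + 2 * b * (- (c + 1) / (2 * b)) + c
    = -1 by field.
  by rewrite oppr_ge0 ler10.
have := h (- b / a).
have -> : a * (- b / a) ^+ 2 + 2 * b * (- b / a) + c = (a * c - b ^+ 2) / a.
  by field; rewrite gt_eqF.
by rewrite pmulr_lge0 ?invr_gt0 // subr_ge0.
Qed.

(** Discriminant of the nonnegative polynomial [nrm (t y + x) ^+ 2] in [t]. *)
Lemma sqr_rinner_le x y : rinner x y ^+ 2 <= nrm x ^+ 2 * nrm y ^+ 2.
Proof.
rewrite mulrC; apply: discriminant_le (exprn_ge0 _ (nrm_ge0 _)) _ => t.
have := exprn_ge0 2 (nrm_ge0 (t%:C%C *: y + x)).
by rewrite !sqr_nrm !rinnerE [rinner y x]rinnerC; congr (0 <= _); ring.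
Qed.

Lemma rinner_le x y : rinner x y <= nrm x * nrm y.
Proof.
apply: (le_trans (ler_norm _)).
rewrite -(@ler_pXn2r _ 2) // ?nnegrE ?mulr_ge0 ?nrm_ge0 //.
by rewrite real_normK ?num_real // exprMn sqr_rinner_le.
Qed.

Lemma inner_le x y : nrm (inner x y) <= nrm x * nrm y.
Proof.
(* Rotating x by the conjugate of <x, y> makes the inner product real. *)
set c := inner x y.
have [c0|c0] := eqVneq (nrm c) 0; first by rewrite c0 mulr_ge0 ?nrm_ge0.
have {}c0 : 0 < nrm c by rewrite lt_def c0 nrm_ge0.
have := rinner_le (conjc c *: x) y.
rewrite nrmZ normcJ /rinner linearZl_LR -/c -mulrA.
have -> : Re (conjc c * c) = nrm c * nrm c.
  by rewrite -expr2 sqr_nrmc; case: (c) => ? ? /=; ring.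
by rewrite ler_pM2l.
Qed.

End RealInnerProduct.

(** * Riesz representation by minimization *)

Section Riesz.
Context {R : realType} {H : hilbertType R}.
Implicit Types (x y z u v : H) (t : R).

(** If [z] represents [g], then [J x] below equals [nrm (x - z) ^+ 2 - nrm z ^+ 2], so [z] is sought
    as the limit of a minimizing sequence of [J]. *)
Lemma riesz_real (g : H -> R) (M : R) :
  (forall x y, g (x + y) = g x + g y) ->
  (forall t x, g (t%:C%C *: x) = t * g x) ->
  (forall x, g x <= M * nrm x) ->
  exists z, forall x, g x = rinner x z.
Proof.
move=> gD gZ gM.
pose J x := rinner x x - 2 * g x.
have Jlb x : - M ^+ 2 <= J x.
  rewrite /J -sqr_nrm; have := gM x; have := sqr_ge0 (nrm x - M); nra.
pose E := [set J x | x in [set: H]]%classic.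
have Einf : has_inf E.
  split; first by exists (J 0), 0.
  by exists (- M ^+ 2) => _ [x _ <-].
pose m := inf E.
have mJ x : m <= J x by apply: ge_inf; [case: Einf | exists x].
have /choice[u uJ] (n : nat) : exists x, J x < m + harmonic n.
  by have [_ [x _ <-] ?] := inf_adherent (harmonic_gt0 n) Einf; exists x.
(* The parallelogram law, with J at the midpoint bounded below by m, makes
   minimizing sequences Cauchy. *)
have Jpar x y : nrm (x - y) ^+ 2 <= 2 * ((J x - m) + (J y - m)).
  have := mJ ((2^-1)%:C%C *: (x + y)).
  rewrite /J !sqr_nrm gZ gD !rinnerE [rinner y x]rinnerC; lra.
have hsmall e : 0 < e -> \forall n \near \oo%classic, harmonic n < e :> R.
  by move=> e0; exact: (near_infty_natSinv_lt (PosNum e0)).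
have /cvg_ex[z uz] : cvg (u @ \oo)%classic.
  apply/cauchy_cvgP/cauchy_exP => e e0.
  have eE : e = (Re e)%:C%C by rewrite RRe_real // gtr0_real.
  have {}e0 : 0 < Re e by move: e0; rewrite eE ltcR.
  (* With both excesses over [m] below this value, [Jpar] bounds the squared distance by
     [Re e ^+ 2]. *)
  have d0 : 0 < Re e ^+ 2 / 4 by rewrite divr_gt0 ?exprn_gt0.
  have [N _ hN] := hsmall _ d0.
  exists (u N); exists N => // n Nn.
  rewrite /= -ball_normE /= eE nrmE ltcR.
  rewrite -(@ltr_pXn2r _ 2) // ?nnegrE ?nrm_ge0 ?(ltW e0) //.
  apply: le_lt_trans (Jpar _ _) _.
  have := uJ N; have := uJ n; have := hN _ (leqnn N); have := hN _ Nn; lra.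
exists z => v.
(* Since [u n] is minimal up to [harmonic n], the quadratic [J (u n + t v) - J (u n) + harmonic n]
   is nonnegative in [t]; its discriminant gives [hu]. Replacing [u n] by [z] costs a Cauchy-Schwarz
   term and the factor 2 of [(a + b)^2 <= 2 (a^2 + b^2)]. *)
have key n : (rinner v z - g v) ^+ 2 <=
    2 * (nrm v ^+ 2 * (harmonic n + nrm (z - u n) ^+ 2)).
  have hu : (rinner v (u n) - g v) ^+ 2 <= nrm v ^+ 2 * harmonic n.
    apply: discriminant_le => [|t]; first exact: sqr_ge0.
    have := mJ (u n + t%:C%C *: v); have := uJ n.
    rewrite /J gD gZ sqr_nrm !rinnerE [rinner (u n) v]rinnerC; lra.
  have := sqr_rinner_le v (z - u n); rewrite !rinnerE.
  have := sqr_ge0 (rinner v (u n) - g v - (rinner v z - rinner v (u n))).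
  by move: hu; nra.
apply/eqP; rewrite -subr_eq0 -sqrf_eq0 eq_le sqr_ge0 andbT.
rewrite leNgt; apply/negP => d0.
set e := (g v - rinner v z) ^+ 2 in d0.
(* Once [harmonic n] and [nrm (z - u n) ^+ 2] are below [q], [key] bounds [e] by
   [4 * nrm v ^+ 2 * q], which is less than [e]; the [+ 1] covers [v = 0]. *)
pose q := e / (4 * (nrm v ^+ 2 + 1)).
have p0 : 0 < q.
  by rewrite divr_gt0 // mulr_gt0 // ltr_wpDl ?sqr_ge0.
have s0 : 0 < (Num.sqrt q)%:C%C :> R[i].
  by rewrite ltcR sqrtr_gt0.
near \oo%classic => n.
have hn : harmonic n < q by near: n; exact: hsmall.
have un : `|z - u n| < (Num.sqrt q)%:C%C.
  by near: n; move/cvgrPdist_lt: uz; exact.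
rewrite nrmE ltcR -(@ltr_pXn2r _ 2) ?nnegrE ?nrm_ge0 ?sqrtr_ge0 // in un.
rewrite sqr_sqrtr ?(ltW p0) // in un.
have := key n; rewrite -sqrrN opprB -/e leNgt => /negP; apply.
have -> : e = 4 * (nrm v ^+ 2 + 1) * q.
  by rewrite /q; field; rewrite gt_eqF // ltr_wpDl ?sqr_ge0.
have := sqr_ge0 (nrm v); nra.
Unshelve. all: by end_near.
Qed.

(** The vector representing [Re f] also represents [f]: the imaginary parts agree because
    [Re (f (i x)) = - Im (f x)], and likewise for the inner product. *)
Lemma riesz (f : H -> R[i]) (M : R) :
  (forall x y, f (x + y) = f x + f y) ->
  (forall a x, f (a *: x) = a * f x) ->
  (forall x, nrm (f x) <= M * nrm x) ->
  exists z, forall x, f x = inner x z.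
Proof.
move=> fD fZ fM.
have [||x|z hz] := @riesz_real (fun x => Re (f x)) M.
- by move=> x y; rewrite fD ReD.
- by move=> t x; rewrite fZ ReM /= mul0r subr0.
- apply: le_trans (fM x); apply: le_trans (ler_norm _) _.
  by have := normc_ge_Re (f x); rewrite lecE => /andP[].
exists z => x; apply/eqP; rewrite eq_complex hz eqxx /=.
have := hz ('i%C *: x); rewrite fZ /rinner linearZl_LR !ReM /=; lra.
Qed.

End Riesz.

(** * Adjoint, operator norm, numerical radius and Cartesian parts *)

Section Operators.
Context {R : realType} {H : hilbertType R}.
Implicit Types (A : {linear H -> H}) (T : H -> H) (x y z : H).

Lemma normalize x : x != 0 ->
  exists y, [/\ nrm y = 1, 0 < nrm x & x = (nrm x)%:C%C *: y].
Proof.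
move=> x0; have n0: 0 < nrm x.
  rewrite lt_def nrm_ge0 andbT; apply: contra x0 => /eqP n0.
  by rewrite -normr_eq0 nrmE n0.
exists (((nrm x)^-1)%:C%C *: x); split=> //.
  by rewrite nrmZ nrm_real ?invr_ge0 ?nrm_ge0 // mulVf ?gt_eqF.
by rewrite scalerA -rmorphM divff ?gt_eqF // scale1r.
Qed.

Lemma bounded_operator_nrm A : bounded_operator A ->
  exists2 M, 0 <= M & forall x, nrm (A x) <= M * nrm x.
Proof.
move=> [M hM]; exists `|M| => // x.
have := hM x.
rewrite nrmE [X in _ <= _ * X]nrmE -rmorphM lecR => /le_trans; apply.
by rewrite ler_wpM2r ?nrm_ge0 ?ler_norm.
Qed.

Lemma adjointP A : bounded_operator A ->
  forall x y, inner (A x) y = inner x (adjoint A y).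
Proof.
move=> /bounded_operator_nrm[M _ hM] x y; rewrite /adjoint.
case: xgetP => [_ _ //|] nz.
have [|||z hz] := @riesz R H (fun x => inner (A x) y) (M * nrm y).
- by move=> u v; rewrite linearD linearDl.
- by move=> a u; rewrite linearZ linearZl_LR.
- move=> u; apply: le_trans (inner_le _ _) _.
  by rewrite mulrAC ler_wpM2r ?nrm_ge0.
(* In this branch [xget] would return its default because no representing vector exists, which [z]
   contradicts. *)
by have := nz z hz.
Qed.

(** The bound [M] makes the supremum genuine: [sup] of an unbounded set is 0. [T] is a bare function
    so that [cartesian_comb] fits. *)
Lemma nrm_le_opnorm T (M : R) : (forall x, nrm x <= 1 -> nrm (T x) <= M) ->
  forall x, nrm x <= 1 -> nrm (T x) <= opnorm T.
Proof.
move=> hM x x1; apply: ub_le_sup; last first.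
  by exists x => //=; rewrite nrmE lecR.
by exists M => _ [y /= y1 <-]; apply: hM; move: y1; rewrite nrmE lecR.
Qed.

Lemma nrm_le_opnormM A : bounded_operator A ->
  forall x, nrm (A x) <= opnorm A * nrm x.
Proof.
move=> /bounded_operator_nrm[M M0 hM] x.
have [->|x0] := eqVneq x 0; first by rewrite linear0 normr0 mulr0.
have [y [y1 n0 xE]] := normalize x0; rewrite {1}xE.
rewrite linearZ !nrmZ nrm_real ?(ltW n0) // mulrC ler_wpM2r ?(ltW n0) //.
apply: (@nrm_le_opnorm _ M); last by rewrite y1.
by move=> z z1; apply: le_trans (hM z) _; rewrite ler_piMr.
Qed.

Lemma opnorm_le T (c : R) :
  (forall x, nrm x <= 1 -> nrm (T x) <= c) -> opnorm T <= c.
Proof.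
move=> hc; apply: ge_sup; first by exists (nrm (T 0)), 0 => //=; rewrite normr0.
by move=> _ [x /= x1 <-]; apply: hc; move: x1; rewrite nrmE lecR.
Qed.

Lemma sup_ge0 (E : set R) : (forall r, E r -> 0 <= r) -> 0 <= sup E.
Proof.
(* An empty or unbounded set has [sup] equal to 0 by convention. *)
move=> E0; have [[[r Er] ubE]|/sup_out -> //] := pselect (has_sup E).
exact: le_trans (E0 _ Er) (ub_le_sup ubE Er).
Qed.

Lemma opnorm_ge0 T : 0 <= opnorm T.
Proof.
by apply: sup_ge0 => _ [x _ <-]; exact: nrm_ge0.
Qed.

Lemma numradius_ge0 T : 0 <= numradius T.
Proof.
by apply: sup_ge0 => _ [x _ <-]; exact: nrm_ge0.
Qed.

(** On the zero space there is no unit vector and the supremum is 0, which is where [0 <= c]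
    enters. *)
Lemma numradius_le T (c : R) : 0 <= c ->
  (forall x, nrm x = 1 -> nrm (inner (T x) x) <= c) -> numradius T <= c.
Proof.
move=> c0 hc; rewrite /numradius.
have [->|/set0P ne] := eqVneq
  [set nrm (inner (T x) x) | x in [set x : H | `|x| = 1]]%classic set0.
  by rewrite sup0.
apply: ge_sup => //.
by move=> _ [x /= x1 <-]; apply: hc; rewrite x1.
Qed.

Lemma nrm_inner_le_numradius A : bounded_operator A ->
  forall x, nrm (inner (A x) x) <= numradius A * nrm x ^+ 2.
Proof.
move=> /bounded_operator_nrm[M M0 hM] x.
have [x0|x0] := eqVneq x 0.
  by rewrite x0 linear0r normr0 mulr_ge0 ?exprn_ge0 ?nrm_ge0 ?numradius_ge0.
have [y [y1 n0 xE]] := normalize x0; rewrite xE; move: (nrm x) (ltW n0) => r r0.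
have -> : inner (A (r%:C%C *: y)) (r%:C%C *: y) = (r ^+ 2)%:C%C * inner (A y) y.
  rewrite [A _]linearZ /= linearZl_LR linearZr_LR /=.
  by rewrite [X in _ * (X * _)](conjc_real r) mulrA -rmorphM.
rewrite nrmM nrmZ y1 mulr1 !nrm_real ?exprn_ge0 //.
rewrite mulrC ler_wpM2r ?exprn_ge0 //.
apply: ub_le_sup; last by exists y => //=; rewrite nrmE y1.
exists M => _ [v /= v1 <-]; apply: le_trans (inner_le _ _) _.
by have := hM v; rewrite v1 !mulr1.
Qed.

(** Treats P+Q and P-Q at once, as the cases [s = 1] and [s = -1]. *)
Definition cartesian_comb (s : R) T x : H := reop T x + s%:C%C *: imop T x.

Lemma inv2CE : 2^-1 = (2^-1)%:C%C :> R[i].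
Proof. by rewrite fmorphV rmorph_nat. Qed.

Lemma inv2iCE : (2 * 'i)^-1 = (2^-1)%:C%C * - 'i%C :> R[i].
Proof. by rewrite invfM invCi inv2CE complexiE. Qed.

(** The right-hand side is free of the adjoint and symmetric in [x] and [y], which is the
    self-adjointness that polarization uses. *)
Lemma rinner_cartesian_comb A (s : R) x y : bounded_operator A ->
  rinner (cartesian_comb s A x) y =
  2^-1 * ((Re (inner (A x) y) + s * Im (inner (A x) y))
        + (Re (inner (A y) x) + s * Im (inner (A y) x))).
Proof.
move=> hA; rewrite /cartesian_comb /reop /imop inv2CE inv2iCE -scalerA.
rewrite rinnerDl !rinnerZl.
have rinnerNi u : rinner (- 'i%C *: u) y = Im (inner u y).
  by rewrite /rinner linearZl_LR ReM /=; ring.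
have -> : rinner (- 'i%C *: (A x - adjoint A x)) y =
    Im (inner (A x) y) + Im (inner (A y) x).
  rewrite rinnerNi innerBl ImD ImN [inner (adjoint A x) y]innerC.
  by rewrite -adjointP // Im_conj opprK.
rewrite !(rinnerDl, rinnerZl) [rinner (adjoint A x) y]rinnerC /rinner.
by rewrite -adjointP //; ring.
Qed.

(** The parallelogram law twice: for Px and Qx, then for Ax and A* x. *)
Lemma nrm_cartesian_comb_parallelogram A x :
  nrm (cartesian_comb 1 A x) ^+ 2 + nrm (cartesian_comb (-1) A x) ^+ 2
  = nrm (A x) ^+ 2 + nrm (adjoint A x) ^+ 2.
Proof.
rewrite /cartesian_comb rmorphN rmorph1 scale1r scaleN1r parallelogram.
have nI : nrm (- 'i%C : R[i]) ^+ 2 = 1 by rewrite sqr_nrmc /=; ring.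
rewrite /reop /imop inv2CE inv2iCE -scalerA !nrmZ !exprMn nI.
rewrite nrm_real ?invr_ge0 // mul1r -mulrDr parallelogram.
by field.
Qed.

(* Polarization: the form <T x, y> of the self-adjoint operator T is recovered
   from its diagonal, which is bounded by sqrt 2 * w(A). *)
Lemma nrm_cartesian_comb_le A (s : R) x : bounded_operator A -> s ^+ 2 = 1 ->
  nrm x <= 1 -> nrm (cartesian_comb s A x) <= Num.sqrt 2 * numradius A.
Proof.
move=> hA s1 x1.
set T := cartesian_comb s A; set w := _ * numradius A.
have w0 : 0 <= w by rewrite mulr_ge0 ?sqrtr_ge0 ?numradius_ge0.
have diag u : `|Re (inner (A u) u) + s * Im (inner (A u) u)| <= w * nrm u ^+ 2.
  have h : `|Re (inner (A u) u) + s * Im (inner (A u) u)|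
           <= Num.sqrt 2 * nrm (inner (A u) u).
    rewrite -(@ler_pXn2r _ 2) ?nnegrE ?mulr_ge0 ?sqrtr_ge0 ?nrm_ge0 //.
    rewrite real_normK ?num_real // exprMn sqr_sqrtr // sqr_nrmc.
    set p := Re _; set q := Im _.
    (* As [s ^+ 2 = 1], the squares of [p + s * q] and [p - s * q] add up to
       [2 * (p ^+ 2 + q ^+ 2)]. *)
    have := sqr_ge0 (p - s * q).
    have -> : (p - s * q) ^+ 2 =
      p ^+ 2 + s ^+ 2 * q ^+ 2 - 2 * (p * (s * q)) by ring.
    have -> : (p + s * q) ^+ 2 =
      p ^+ 2 + s ^+ 2 * q ^+ 2 + 2 * (p * (s * q)) by ring.
    rewrite s1; lra.
  apply: le_trans h _; rewrite -mulrA ler_wpM2l ?sqrtr_ge0 //.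
  exact: nrm_inner_le_numradius.
(* Four times [rinner (T x) y] is the diagonal form at [x + y] minus that at [x - y]; the
   parallelogram law adds up the two bounds. *)
have polar y : 2 * rinner (T x) y <= w * (nrm x ^+ 2 + nrm y ^+ 2).
  have := diag (x + y); have := diag (x - y).
  rewrite !ler_norml => /andP[+ _] /andP[_].
  rewrite rinner_cartesian_comb //.
  rewrite !(linearB A) !(linearD A) !innerBl !innerDl !innerBr !innerDr.
  rewrite !(ReD, ImD, ReN, ImN).
  have := parallelogram x y => /(congr1 ( *%R w)).
  lra.
set N := nrm (T x).
have [->//|N0] := eqVneq N 0.
have {}N0 : 0 < N by rewrite lt_def N0 nrm_ge0.
(* Testing against the unit vector along [T x] gives [2 * N <= w * (nrm x ^+ 2 + 1)], at most
   [2 * w]. *)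
have := polar (N^-1%:C%C *: T x).
rewrite rinnerZr -sqr_nrm nrmZ nrm_real ?invr_ge0 ?(ltW N0) // -/N.
have -> : N^-1 * N ^+ 2 = N by field; rewrite gt_eqF.
rewrite mulVf ?gt_eqF // expr1n.
have : nrm x ^+ 2 <= 1 by rewrite expr_le1 ?nrm_ge0.
nra.
Qed.

Lemma opnorm_cartesian_comb_le A (s : R) : bounded_operator A -> s ^+ 2 = 1 ->
  opnorm (cartesian_comb s A) ^+ 2 <= 2 * numradius A ^+ 2.
Proof.
move=> hA s1.
have -> : 2 * numradius A ^+ 2 = (Num.sqrt 2 * numradius A) ^+ 2.
  by rewrite exprMn sqr_sqrtr.
rewrite ler_pXn2r ?nnegrE ?opnorm_ge0 ?mulr_ge0 ?sqrtr_ge0 ?numradius_ge0 //.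
by apply: opnorm_le => x; apply: nrm_cartesian_comb_le.
Qed.

Lemma sum_sqr_nrm_adjoint_le A x : bounded_operator A -> nrm x <= 1 ->
  nrm (A x) ^+ 2 + nrm (adjoint A x) ^+ 2 <=
  4 * (numradius A ^+ 2 - `| opnorm (reop A \+ imop A) ^+ 2
                          - opnorm (reop A \- imop A) ^+ 2 | / 4).
Proof.
move=> hA x1.
have -> : reop A \+ imop A = cartesian_comb 1 A.
  by apply/funext => y; rewrite /cartesian_comb rmorph1 scale1r.
have -> : reop A \- imop A = cartesian_comb (-1) A.
  by apply/funext => y; rewrite /cartesian_comb rmorphN rmorph1 scaleN1r.
have le_op (s : R) : s ^+ 2 = 1 ->
    nrm (cartesian_comb s A x) ^+ 2 <= opnorm (cartesian_comb s A) ^+ 2.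
  move=> s1; rewrite ler_pXn2r ?nnegrE ?nrm_ge0 ?opnorm_ge0 //.
  by apply: nrm_le_opnorm x1 => y; exact: nrm_cartesian_comb_le.
have s1 : (1 : R) ^+ 2 = 1 by ring.
have s2 : (-1 : R) ^+ 2 = 1 by ring.
rewrite -nrm_cartesian_comb_parallelogram.
have := le_op _ s1; have := le_op _ s2.
have := opnorm_cartesian_comb_le hA s1; have := opnorm_cartesian_comb_le hA s2.
case: (ger0P (_ - _)); lra.
Qed.

(** Adding the two moduli serves both signs of AB +- BA. *)
Lemma nrm_inner_comm_le A B x : bounded_operator A -> bounded_operator B ->
  nrm x = 1 ->
  nrm (inner (A (B x)) x) + nrm (inner (B (A x)) x) <=
  opnorm B * (nrm (A x) + nrm (adjoint A x)).
Proof.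
move=> hA hB x1.
rewrite adjointP // mulrDr addrC; apply: lerD.
  by apply: le_trans (inner_le _ _) _; rewrite x1 mulr1 nrm_le_opnormM.
apply: le_trans (inner_le _ _) _; rewrite ler_wpM2r ?nrm_ge0 //.
by have := nrm_le_opnormM hB x; rewrite x1 mulr1.
Qed.

End Operators.

Theorem corollary3p8 (R : realType) (H : hilbertType R) (A B : {linear H -> H})
    (hA : bounded_operator A) (hB : bounded_operator B) :
  let rhs := 2 * Num.sqrt 2 * opnorm B *
    Num.sqrt (numradius A ^+ 2 -
      `| opnorm (reop A \+ imop A) ^+ 2 - opnorm (reop A \- imop A) ^+ 2 | / 4) in
  numradius ((A \o B) \+ (B \o A)) <= rhs /\
  numradius ((A \o B) \- (B \o A)) <= rhs.
Proof.
move=> rhs.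
have rhs0 : 0 <= rhs by rewrite !mulr_ge0 ?sqrtr_ge0 ?opnorm_ge0.
have bound x : nrm x = 1 ->
    nrm (inner (A (B x)) x) + nrm (inner (B (A x)) x) <= rhs.
  move=> x1; apply: le_trans (nrm_inner_comm_le hA hB x1) _.
  rewrite /rhs [2 * _ * _]mulrC -[_ * _ * Num.sqrt _]mulrA.
  rewrite ler_wpM2l ?opnorm_ge0 //.
  have xle : nrm x <= 1 by rewrite x1.
  have := sum_sqr_nrm_adjoint_le hA xle.
  set D := numradius A ^+ 2 - _.
  set p := nrm (A x); set q := nrm (adjoint A x) => hpq.
  (* Nonnegativity of [D] matters because [Num.sqrt] is 0 on negative numbers; it follows from
     [hpq]. *)
  have D0 : 0 <= D by have := sqr_ge0 p; have := sqr_ge0 q; lra.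
  have p0 : 0 <= p by exact: nrm_ge0.
  have q0 : 0 <= q by exact: nrm_ge0.
  rewrite -(@ler_pXn2r _ 2) ?nnegrE ?addr_ge0 ?mulr_ge0 ?sqrtr_ge0 //.
  rewrite !exprMn !sqr_sqrtr //.
  (* [(p + q)^2 <= 2 (p^2 + q^2) <= 8 D], the square of [2 * Num.sqrt 2 * Num.sqrt D]. *)
  have := sqr_ge0 (p - q); nra.
split; apply: numradius_le => // x x1; apply: le_trans (bound x x1).
  rewrite [inner _ _](innerDl (A (B x)) (B (A x)) x); exact: ler_nrmD.
rewrite [inner _ _](innerBl (A (B x)) (B (A x)) x).
by rewrite -[X in _ <= _ + Re X]normrN; exact: ler_nrmD.
Qed.
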